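(* Let $n$ be a positive integer with $4<n$ such that $s^{n,4}=\binom{n+1}{2}/4$ is an integer. Let $1<p_1\le p_2\le p_3\le p_4$ be integers with $p_1+p_2+p_3+p_4=n$, and put $P_j=\sum_{i=1}^{j}p_i$ for $j=1,\dots,4$. Then there exists a partition $\{A_1,A_2,A_3,A_4\}$ of $[n]=\{1,\dots,n\}$ with $|A_i|=p_i$ and $\sum_{a\in A_i}a=s^{n,4}$ for all $i=1,\dots,4$ if and only if $$\sum_{i=1}^{P_j}(n-i+1)\ \ge\ j\, s^{n,4}\qquad\text{for all } j=1,2,3,4.$$
   Context: Equivalently: the complete 4-partite graph $K_{p_1,p_2,p_3,p_4}$ has a distance magic labeling (a bijection $f:V\to[n]$ such that $\sum_{y\in N(x)}f(y)$ is the same for all vertices $x$) if and only if the displayed inequalities hold. *)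

(* Defs.v *)
From mathcomp Require Import all_boot.

Set Implicit Arguments.
Unset Strict Implicit.
Unset Printing Implicit Defensive.

(* [n] = {1, ..., n}, inside 'I_n.+1 so that each element has its literal
   value. *)
Definition interval1 (n : nat) : {set 'I_n.+1} := [set a : 'I_n.+1 | 0 < a].

(* s^{n,k}: the quotient is exact only when k divides 'C(n.+1, 2). *)
Definition magic_sum (n k : nat) : nat := 'C(n.+1, 2) %/ k.

(* P_j = p_1 + ... + p_j, where p_i is p at the ordinal of value i - 1. *)
Definition partial_sum (k : nat) (p : 'I_k -> nat) (j : nat) : nat :=
  \sum_(i < k | i < j) p i.

(* Injectivity makes the blocks of the partition correspond one-to-one to
   their indices. *)
Definition labeled_partition (k : nat) (T : finType) (A : 'I_k -> {set T})
    (D : {set T}) : Prop :=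
  injective A /\ partition [set A i | i : 'I_k] D.

(* Main.v *)
(* Necessity: the first j blocks are P_j distinct elements of [n], so their
   sum j s is at most that of the P_j largest ones.

   Sufficiency: we characterise, for four blocks of sizes p_i >= 3, all the
   vectors of sums that occur.  Write d_i for the sum of the p_i largest
   elements of [n] minus the prescribed sum of block i.  For a set J of blocks,
   the corresponding difference is
     d_J = sum_(i in J) d_i - sum_(i < j in J) p_i p_j,
   so one needs d_J >= 0, with equality when J contains all blocks; this is
   shown to suffice, by induction on n.
   - Handing n to block i replaces d_j by d_j - p_j for j <> i; it preserves
     the conditions iff d_J >= p_J (the total size of J) for all J avoiding i.
     Handing out 1 instead is the same thing after the reflection
     a |-> n + 1 - a, which replaces d_i by p_i (n - p_i) - d_i.
   - If d_i < p_i for some i, then block i can receive n.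
   - If d_i >= p_i for all i, before and after reflection, then any block can
     receive either n or 1, so one decreases a block of size > 3.
   - A block i of size 3 with d_i < 3 is completed at once: it receives the four
     largest elements but one, which is handed to another block (just the three
     largest elements if d_i = 0).  This leaves the same problem with three
     blocks of sizes >= 2, which is solved in the same way.
   - The remaining case, all blocks of size 3, is a finite verification.
   Finally, for equal sums the condition j = 1 forces p_1 >= 3 unless n = 8. *)

Require Import Defs.
From mathcomp Require Import all_boot perm zify.

Set Implicit Arguments.
Unset Strict Implicit.
Unset Printing Implicit Defensive.

(** * Words of block labels and their slacks *)

(* For a word listing the blocks of n, ..., 1, this is the number of pairs
   a < b with a in block c and b outside: the amount by which the sum of block
   c falls short of the sum of the largest elements. *)
Fixpoint slack (T : eqType) (c : T) (w : seq T) : nat :=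
  if w is x :: w' then slack c w' + (x != c) * count_mem c w' else 0.

Lemma slack_rcons (T : eqType) (c x : T) w :
  slack c (rcons w x) = slack c w + (x == c) * count (predC1 c) w.
Proof.
elim: w => [|y w IHw] /=; first by rewrite !muln0.
rewrite IHw -cats1 count_cat /=.
by case: (x == c); case: (y == c) => /=; lia.
Qed.

(** Each pair of positions with exactly one letter [c] is counted by exactly one of [w] and
    [rev w]. *)
Lemma slack_rev (T : eqType) (c : T) w :
  slack c (rev w) + slack c w = count_mem c w * count (predC1 c) w.
Proof.
elim: w => [|x w IHw] //=.
rewrite rev_cons slack_rcons !count_rev.
by case: (x == c) => /=; lia.
Qed.

Lemma slack_map (T : eqType) (f : T -> T) (c : T) w :
  injective f -> slack (f c) [seq f x | x <- w] = slack c w.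
Proof.
move=> f_inj; elim: w => [|x w IHw] //=.
rewrite IHw (inj_eq f_inj) count_map; congr (_ + _ * _).
by apply: eq_count => y /=; rewrite (inj_eq f_inj).
Qed.

(** The letter at position [size w - a] is the block of [a]; the guard [0 < a] keeps out the default
    letter [x0]. *)
Definition word_sum (T : eqType) (x0 : T) (F : nat -> nat) (c : T) (w : seq T) : nat :=
  \sum_(a < (size w).+1 | (0 < a) && (nth x0 w (size w - a) == c)) F a.

Lemma word_sum_cons (T : eqType) (x0 : T) F (c x : T) w :
  word_sum x0 F c (x :: w) = word_sum x0 F c w + (x == c) * F (size w).+1.
Proof.
rewrite /word_sum /= big_mkcond big_ord_recr /= subnn /= -big_mkcond /=.
congr (_ + _); last by case: (x == c); rewrite ?mul1n.
apply: eq_bigl => a; case: (posnP a) => //= a_gt0.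
by rewrite subSn // -ltnS ltn_ord.
Qed.

Lemma word_sum1 (T : eqType) (x0 c : T) w :
  word_sum x0 (fun=> 1) c w = count_mem c w.
Proof.
elim: w => [|x w IHw]; last by rewrite word_sum_cons IHw muln1 addnC.
by rewrite /word_sum big_mkcond big_ord_recl big_ord0.
Qed.

(** Twice the sum of the m largest elements of [n] is m(2n + 1) - m^2; adding m^2 on the left avoids
    subtraction. *)
Lemma word_sum_slack (T : eqType) (x0 c : T) w :
  2 * (word_sum x0 id c w + slack c w) + count_mem c w ^ 2
  = count_mem c w * (2 * size w).+1.
Proof.
elim: w => [|x w IHw].
  by rewrite /word_sum big_mkcond big_ord_recl big_ord0.
by rewrite word_sum_cons /=; case: (x == c) => /=; lia.
Qed.

(** * Realizable and admissible vectors, and their symmetries *)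

Definition realizable (p1 p2 p3 p4 d1 d2 d3 d4 : nat) : Prop :=
  exists w : seq 'I_4, forall c : 'I_4,
    count_mem c w = nth 0 [:: p1; p2; p3; p4] c /\
    slack c w = nth 0 [:: d1; d2; d3; d4] c.

(* The conditions d_J >= 0; those with |J| = 3 appear, thanks to the first
   equation, as upper bounds for the remaining d_i. *)
Definition admissible (p1 p2 p3 p4 d1 d2 d3 d4 : nat) : bool :=
  [&& d1 + d2 + d3 + d4
      == p1 * p2 + p1 * p3 + p1 * p4 + p2 * p3 + p2 * p4 + p3 * p4,
      p1 * p2 <= d1 + d2, p1 * p3 <= d1 + d3, p1 * p4 <= d1 + d4,
      p2 * p3 <= d2 + d3, p2 * p4 <= d2 + d4, p3 * p4 <= d3 + d4,
      d1 <= p1 * (p2 + p3 + p4), d2 <= p2 * (p1 + p3 + p4),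
      d3 <= p3 * (p1 + p2 + p4) & d4 <= p4 * (p1 + p2 + p3)].

(* The inequalities d_J >= p_J for J a nonempty subset of {2, 3, 4}. *)
Definition accepts1 (p2 p3 p4 d2 d3 d4 : nat) : bool :=
  [&& p2 <= d2, p3 <= d3, p4 <= d4,
      p2 * p3 + p2 + p3 <= d2 + d3, p2 * p4 + p2 + p4 <= d2 + d4,
      p3 * p4 + p3 + p4 <= d3 + d4 &
      p2 * p3 + p2 * p4 + p3 * p4 + p2 + p3 + p4 <= d2 + d3 + d4].

Lemma realizable_map (f : 'I_4 -> 'I_4) p1 p2 p3 p4 d1 d2 d3 d4 q1 q2 q3 q4 e1 e2 e3 e4 :
  injective f ->
  (forall c : 'I_4, nth 0 [:: q1; q2; q3; q4] (f c) = nth 0 [:: p1; p2; p3; p4] c /\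
     nth 0 [:: e1; e2; e3; e4] (f c) = nth 0 [:: d1; d2; d3; d4] c) ->
  realizable p1 p2 p3 p4 d1 d2 d3 d4 -> realizable q1 q2 q3 q4 e1 e2 e3 e4.
Proof.
move=> f_inj fE [w wE]; exists [seq f x | x <- w] => c.
have [g gK fK] := injF_bij f_inj.
rewrite -(fK c) slack_map // count_map; have [-> ->] := fE (g c).
have [<- <-] := wE (g c); split => //.
by apply: eq_count => y /=; rewrite (inj_eq f_inj).
Qed.

Ltac ord4 c := case: c => [[|[|[|[|c]]]] c_lt] //=.

Lemma realizable_swap12 p1 p2 p3 p4 d1 d2 d3 d4 :
  realizable p2 p1 p3 p4 d2 d1 d3 d4 -> realizable p1 p2 p3 p4 d1 d2 d3 d4.
Proof.
apply: (@realizable_map (tperm (inord 0) (inord 1))); first exact: perm_inj.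
by move=> c; rewrite permE /=; ord4 c; rewrite -!val_eqE /= !inordK.
Qed.

Lemma realizable_swap23 p1 p2 p3 p4 d1 d2 d3 d4 :
  realizable p1 p3 p2 p4 d1 d3 d2 d4 -> realizable p1 p2 p3 p4 d1 d2 d3 d4.
Proof.
apply: (@realizable_map (tperm (inord 1) (inord 2))); first exact: perm_inj.
by move=> c; rewrite permE /=; ord4 c; rewrite -!val_eqE /= !inordK.
Qed.

Lemma realizable_swap34 p1 p2 p3 p4 d1 d2 d3 d4 :
  realizable p1 p2 p4 p3 d1 d2 d4 d3 -> realizable p1 p2 p3 p4 d1 d2 d3 d4.
Proof.
apply: (@realizable_map (tperm (inord 2) (inord 3))); first exact: perm_inj.
by move=> c; rewrite permE /=; ord4 c; rewrite -!val_eqE /= !inordK.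
Qed.

Lemma realizable_swap13 p1 p2 p3 p4 d1 d2 d3 d4 :
  realizable p3 p2 p1 p4 d3 d2 d1 d4 -> realizable p1 p2 p3 p4 d1 d2 d3 d4.
Proof.
by move=> H; apply/realizable_swap12/realizable_swap23/realizable_swap12.
Qed.

Lemma realizable_swap14 p1 p2 p3 p4 d1 d2 d3 d4 :
  realizable p4 p2 p3 p1 d4 d2 d3 d1 -> realizable p1 p2 p3 p4 d1 d2 d3 d4.
Proof.
by move=> H; apply/realizable_swap13/realizable_swap34/realizable_swap13.
Qed.

(** Reversing the word reflects a to n + 1 - a. The upper bounds in [admissible] make the
    subtractions exact. *)
Lemma realizable_flip p1 p2 p3 p4 d1 d2 d3 d4 :
  admissible p1 p2 p3 p4 d1 d2 d3 d4 ->
  realizable p1 p2 p3 p4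
    (p1 * (p2 + p3 + p4) - d1) (p2 * (p1 + p3 + p4) - d2)
    (p3 * (p1 + p2 + p4) - d3) (p4 * (p1 + p2 + p3) - d4) ->
  realizable p1 p2 p3 p4 d1 d2 d3 d4.
Proof.
move=> adm [w wE]; exists (rev w) => c; rewrite count_rev.
have [cE sE] := wE c; split => //.
have size_w : size w = p1 + p2 + p3 + p4.
  rewrite -sum1_size (partition_big id xpredT) //= !big_ord_recl big_ord0.
  by rewrite !sum1_count !(proj1 (wE _)) /= !addnA addn0.
have := slack_rev c w.
have -> : count (predC1 c) w = size w - count_mem c w.
  by rewrite -(count_predC (pred1 c) w) addKn.
move: adm; rewrite /admissible cE sE size_w.
move: (slack c (rev w)) => s; clear w wE cE sE size_w; ord4 c; nia.
Qed.

(** * Handing out the largest element *)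

Lemma realizable_top1 p1 p2 p3 p4 d1 d2 d3 d4 :
  p2 <= d2 -> p3 <= d3 -> p4 <= d4 ->
  realizable p1 p2 p3 p4 d1 (d2 - p2) (d3 - p3) (d4 - p4) ->
  realizable p1.+1 p2 p3 p4 d1 d2 d3 d4.
Proof.
move=> le2 le3 le4 [w wE]; exists (ord0 :: w) => c /=.
have [-> ->] := wE c; ord4 c; by rewrite ?mul1n ?mul0n ?addn0 ?subnK.
Qed.

Lemma admissible_top1 p1 p2 p3 p4 d1 d2 d3 d4 :
  admissible p1.+1 p2 p3 p4 d1 d2 d3 d4 -> accepts1 p2 p3 p4 d2 d3 d4 ->
  admissible p1 p2 p3 p4 d1 (d2 - p2) (d3 - p3) (d4 - p4).
Proof. by rewrite /admissible /accepts1; lia. Qed.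

Lemma admissible_flip p1 p2 p3 p4 d1 d2 d3 d4 :
  admissible p1 p2 p3 p4 d1 d2 d3 d4 ->
  admissible p1 p2 p3 p4
    (p1 * (p2 + p3 + p4) - d1) (p2 * (p1 + p3 + p4) - d2)
    (p3 * (p1 + p2 + p4) - d3) (p4 * (p1 + p2 + p3) - d4).
Proof. by rewrite /admissible; lia. Qed.

(** The bounds e_i <= d_i let a caller conclude that a zero slack of an empty block stays zero. *)
Lemma top1_step p1 p2 p3 p4 d1 d2 d3 d4 :
  (forall q1 q2 q3 q4 e1 e2 e3 e4,
     q1 = p1 -> q2 = p2 -> q3 = p3 -> q4 = p4 ->
     e1 = d1 -> e2 <= d2 -> e3 <= d3 -> e4 <= d4 ->
     admissible q1 q2 q3 q4 e1 e2 e3 e4 ->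
     realizable q1 q2 q3 q4 e1 e2 e3 e4) ->
  admissible p1.+1 p2 p3 p4 d1 d2 d3 d4 -> accepts1 p2 p3 p4 d2 d3 d4 ->
  realizable p1.+1 p2 p3 p4 d1 d2 d3 d4.
Proof.
move=> IH adm acc; have /and4P[le2 le3 le4 _] := acc.
apply: realizable_top1 => //; apply: IH => //; try exact: leq_subr.
exact: admissible_top1.
Qed.

(** Let J avoid 1, with p_J > 0. Since d of J with 1 added is nonnegative, d_J >= p_1 p_J - d_1 >=
    p_1 (p_J - 1) + 1 >= p_J. *)
Lemma tight1_accepts1 p1 p2 p3 p4 d1 d2 d3 d4 :
  admissible p1 p2 p3 p4 d1 d2 d3 d4 -> d1 < p1 ->
  accepts1 p2 p3 p4 d2 d3 d4.
Proof. by rewrite /admissible /accepts1; nia. Qed.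

Definition loose (p1 p2 p3 p4 d1 d2 d3 d4 : nat) : bool :=
  [&& p1 <= d1, p2 <= d2, p3 <= d3 & p4 <= d4].

(** Write d' for the reflected differences; d'_K is d of the complement of K. If J obstructs n and K
    obstructs 1, looseness forces both to have at least two blocks, and d_J + d'_K = d_(J - K) +
    d'_(K - J) + p_(J & K) p_R, where R is the complement of their union. Each difference has at
    most one block and R contains block 1, so this is at least p_(J - K) + p_(K - J) + 2 p_(J & K) =
    p_J + p_K, a contradiction. *)
Lemma loose_accepts1 p1 p2 p3 p4 d1 d2 d3 d4 :
  1 < p1 ->
  admissible p1 p2 p3 p4 d1 d2 d3 d4 ->
  loose p1 p2 p3 p4 d1 d2 d3 d4 ->
  loose p1 p2 p3 p4
    (p1 * (p2 + p3 + p4) - d1) (p2 * (p1 + p3 + p4) - d2)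
    (p3 * (p1 + p2 + p4) - d3) (p4 * (p1 + p2 + p3) - d4) ->
  accepts1 p2 p3 p4 d2 d3 d4 \/
  accepts1 p2 p3 p4 (p2 * (p1 + p3 + p4) - d2)
    (p3 * (p1 + p2 + p4) - d3) (p4 * (p1 + p2 + p3) - d4).
Proof.
move=> p1_gt1 adm lo lo'; apply/orP; rewrite -[_ || _]negbK negb_or.
have h2 : 2 * p2 <= p1 * p2 by rewrite leq_mul2r p1_gt1 orbT.
have h3 : 2 * p3 <= p1 * p3 by rewrite leq_mul2r p1_gt1 orbT.
have h4 : 2 * p4 <= p1 * p4 by rewrite leq_mul2r p1_gt1 orbT.
by move: adm lo lo'; rewrite /admissible /loose /accepts1; lia.
Qed.

(** * Two blocks *)

Lemma realizable0 : realizable 0 0 0 0 0 0 0 0.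
Proof. by exists [::] => c; ord4 c. Qed.

(** If neither of two nonempty blocks could receive n, then p_1 p_2 = d_1 + d_2 <= (p_1 - 1) + (p_2
    - 1), which is impossible. *)
Lemma realizable_two p1 p2 d1 d2 :
  admissible p1 p2 0 0 d1 d2 0 0 -> realizable p1 p2 0 0 d1 d2 0 0.
Proof.
have [n] := ubnP (p1 + p2); elim: n => // n IHn in p1 p2 d1 d2 *.
wlog /andP[p1_gt0 le2] : p1 p2 d1 d2 / (0 < p1) && (p2 <= d2)
    => [wlog1 | le_n adm].
  move=> le_n adm; have [h1|h1] := boolP ((0 < p1) && (p2 <= d2)).
    exact: wlog1.
  have [h2|h2] := boolP ((0 < p2) && (p1 <= d1)).
    apply: realizable_swap12; apply: wlog1 => //; first by rewrite addnC.
    by move: adm; rewrite /admissible; lia.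
  have [-> -> -> ->] : [/\ p1 = 0, p2 = 0, d1 = 0 & d2 = 0].
    move: adm h1 h2; rewrite /admissible.
    by case: (p1) (p2) => [|q1] [|q2]; split; nia.
  exact: realizable0.
case: p1 p1_gt0 le_n adm => // p1 _ le_n adm.
apply: top1_step (adm) _ => [q1 q2 q3 q4 e1 e2 e3 e4|].
  move=> -> -> -> -> _ _; rewrite !leqn0 => /eqP-> /eqP->.
  by apply: IHn; lia.
by move: adm; rewrite /admissible /accepts1; lia.
Qed.

(** * Verified search, and four blocks of size 3 *)

(* Unlike [&&] and [||], these do not evaluate their second argument under
   call by value, which would make [search] explore all 4 ^ n words. *)
Local Notation "b1 '&&&' b2" := (if b1 then b2 else false)
  (at level 40, left associativity).
Local Notation "b1 '|||' b2" := (if b1 then true else b2)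
  (at level 50, left associativity).

Fixpoint search (n p1 p2 p3 p4 d1 d2 d3 d4 : nat) : bool :=
  if n is n'.+1 then
    admissible p1 p2 p3 p4 d1 d2 d3 d4 &&&
    ([&& 0 < p1, p2 <= d2, p3 <= d3 & p4 <= d4] &&&
       search n' p1.-1 p2 p3 p4 d1 (d2 - p2) (d3 - p3) (d4 - p4)
     ||| [&& 0 < p2, p1 <= d1, p3 <= d3 & p4 <= d4] &&&
       search n' p1 p2.-1 p3 p4 (d1 - p1) d2 (d3 - p3) (d4 - p4)
     ||| [&& 0 < p3, p1 <= d1, p2 <= d2 & p4 <= d4] &&&
       search n' p1 p2 p3.-1 p4 (d1 - p1) (d2 - p2) d3 (d4 - p4)
     ||| [&& 0 < p4, p1 <= d1, p2 <= d2 & p3 <= d3] &&&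
       search n' p1 p2 p3 p4.-1 (d1 - p1) (d2 - p2) (d3 - p3) d4)
  else all (pred1 0) [:: p1; p2; p3; p4; d1; d2; d3; d4].

Lemma searchP n p1 p2 p3 p4 d1 d2 d3 d4 :
  search n p1 p2 p3 p4 d1 d2 d3 d4 -> realizable p1 p2 p3 p4 d1 d2 d3 d4.
Proof.
elim: n p1 p2 p3 p4 d1 d2 d3 d4 => [|n IHn] p1 p2 p3 p4 d1 d2 d3 d4 /=.
  by do ?[case/andP=> /eqP->]; move=> _; exact: realizable0.
(* The lazy connectives are the bodies of [andb] and [orb]; folding them back makes the views
   applicable. *)
rewrite -/(andb _ _) -/(orb _ _); case/andP=> _.
rewrite -4!/(andb _ _) -3!/(orb _ _) -!orbA.
case/or4P=> /andP[/and4P[]].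
- case: p1 => // p1 _ *; apply: realizable_top1 => //; exact: IHn.
- case: p2 => // p2 _ *; apply/realizable_swap12/realizable_top1 => //.
  by apply/realizable_swap12; apply: IHn.
- case: p3 => // p3 _ *; apply/realizable_swap13/realizable_top1 => //.
  by apply/realizable_swap13; apply: IHn.
- case: p4 => // p4 _ *; apply/realizable_swap14/realizable_top1 => //.
  by apply/realizable_swap14; apply: IHn.
Qed.

(** Insertion sort by adjacent swaps: [bubble] inserts the last argument into a sorted triple. *)
Lemma sort4 (P : nat -> nat -> nat -> nat -> Prop) :
  (forall a b c d, P b a c d -> P a b c d) ->
  (forall a b c d, P a c b d -> P a b c d) ->
  (forall a b c d, P a b d c -> P a b c d) ->
  (forall a b c d, a <= b -> b <= c -> c <= d -> P a b c d) ->
  forall a b c d, P a b c d.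
Proof.
move=> P12 P23 P34 Pmono.
have bubble a b c d : a <= b -> b <= c -> P a b c d.
  have [le_cd|/ltnW le_dc] := leqP c d; first by move=> *; exact: Pmono.
  move=> le_ab le_bc; apply: P34.
  have [le_bd|/ltnW le_db] := leqP b d; first exact: Pmono.
  apply: P23; have [le_ad|/ltnW le_da] := leqP a d; first exact: Pmono.
  by apply: P12; apply: Pmono.
move=> a b c d.
wlog le_ab : a b / a <= b.
  by case/orP: (leq_total a b) => h H; [|apply: P12]; exact: H.
have [le_bc|/ltnW le_cb] := leqP b c; first exact: bubble.
apply: P23; have [le_ac|/ltnW le_ca] := leqP a c; first exact: bubble.
by apply: P12; apply: bubble.
Qed.

(** Here 54 is the sum of the six products 3 * 3, and each d_i is at most 3 * 9 = 27. By symmetry d1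
    <= d2 <= d3 is enough. *)
Definition search_all3333 : bool :=
  all (fun d1 => all (fun d2 => all (fun d3 =>
    let d4 := 54 - (d1 + d2 + d3) in
    if admissible 3 3 3 3 d1 d2 d3 d4 then search 12 3 3 3 3 d1 d2 d3 d4
    else true)
    (iota d2 (28 - d2))) (iota d1 (28 - d1))) (iota 0 28).

Lemma search_all3333_holds : search_all3333.
Proof. by vm_compute. Qed.

Lemma realizable3333 d1 d2 d3 d4 :
  admissible 3 3 3 3 d1 d2 d3 d4 -> realizable 3 3 3 3 d1 d2 d3 d4.
Proof.
move: d1 d2 d3 d4; apply: sort4.
- move=> a b c d H adm; apply/realizable_swap12/H.
  by move: adm; rewrite /admissible; lia.
- move=> a b c d H adm; apply/realizable_swap23/H.
  by move: adm; rewrite /admissible; lia.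
- move=> a b c d H adm; apply/realizable_swap34/H.
  by move: adm; rewrite /admissible; lia.
move=> a b c d le_ab le_bc le_cd adm.
have [a28 b28 c28 dE] : [/\ a < 28, b < 28, c < 28 & d = 54 - (a + b + c)].
  by move: adm; rewrite /admissible; split; lia.
have a_in : a \in iota 0 28 by rewrite mem_iota; lia.
have b_in : b \in iota a (28 - a) by rewrite mem_iota; lia.
have c_in : c \in iota b (28 - b) by rewrite mem_iota; lia.
have /allP/(_ a a_in)/allP/(_ b b_in)/allP/(_ c c_in) := search_all3333_holds.
by cbv zeta; rewrite -dE adm => found; exact: searchP found.
Qed.

(** * Completing a block with small slack *)

Lemma admissible_swap12 p1 p2 p3 p4 d1 d2 d3 d4 :
  admissible p1 p2 p3 p4 d1 d2 d3 d4 -> admissible p2 p1 p3 p4 d2 d1 d3 d4.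
Proof. by rewrite /admissible; lia. Qed.

Lemma admissible_swap13 p1 p2 p3 p4 d1 d2 d3 d4 :
  admissible p1 p2 p3 p4 d1 d2 d3 d4 -> admissible p3 p2 p1 p4 d3 d2 d1 d4.
Proof. by rewrite /admissible; lia. Qed.

Lemma admissible_swap14 p1 p2 p3 p4 d1 d2 d3 d4 :
  admissible p1 p2 p3 p4 d1 d2 d3 d4 -> admissible p4 p2 p3 p1 d4 d2 d3 d1.
Proof. by rewrite /admissible; lia. Qed.

Lemma drain1 p1 p2 p3 p4 d2 d3 d4 :
  (forall e2 e3 e4, admissible 0 p2 p3 p4 0 e2 e3 e4 ->
     realizable 0 p2 p3 p4 0 e2 e3 e4) ->
  admissible p1 p2 p3 p4 0 d2 d3 d4 -> realizable p1 p2 p3 p4 0 d2 d3 d4.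
Proof.
move=> rest; elim: p1 d2 d3 d4 => [|p1 IHp1] d2 d3 d4 adm; first exact: rest.
apply: top1_step (adm) (tight1_accepts1 adm _) => //.
by move=> *; subst; exact: IHp1.
Qed.

(** The single element of block 1 must be n - 1, so n goes to block 2 or 3. Only d_3 < 2 p_3
    excludes block 2, only d_2 < 2 p_2 excludes block 3, and together they contradict d_2 + d_3 =
    p_2 p_3 + p_2 + p_3 - 1. *)
Lemma skip1_three p2 p3 d2 d3 :
  1 < p2 -> 1 < p3 -> admissible 1 p2 p3 0 1 d2 d3 0 ->
  accepts1 1 p3 0 1 d3 0 \/ accepts1 p2 1 0 d2 1 0.
Proof.
move=> p2_gt1 p3_gt1; rewrite /admissible => adm.
have h23 : 2 * p2 + 2 * p3 <= p2 * p3 + 4 by nia.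
have [h3|h3] := leqP (2 * p3) d3; [left|right]; rewrite /accepts1.
  by move: adm; lia.
by move: adm; lia.
Qed.

Lemma skip1_four p1 p2 p3 p4 d2 d3 d4 :
  0 < p1 <= 2 -> 2 < p2 -> 2 < p3 -> 2 < p4 ->
  admissible p1 p2 p3 p4 p1 d2 d3 d4 ->
  [\/ accepts1 p1 p3 p4 p1 d3 d4, accepts1 p2 p1 p4 d2 p1 d4
    | accepts1 p2 p3 p1 d2 d3 p1].
Proof.
move=> p1_int p2_gt p3_gt p4_gt adm.
(* These three bounds say (p_i - 3)(p_j - 3) >= 0. *)
have h23 : 3 * p2 + 3 * p3 <= p2 * p3 + 9 by nia.
have h24 : 3 * p2 + 3 * p4 <= p2 * p4 + 9 by nia.
have h34 : 3 * p3 + 3 * p4 <= p3 * p4 + 9 by nia.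
move: adm; rewrite /admissible.
case/and5P=> ? ? ? ? /and5P[? ? ? ? /and3P[? ? ?]].
(* If d_i < (p_1 + 1) p_i, the set {1, i} obstructs every other recipient, so block i receives n.
   Otherwise the sets {1, 3, 4} and {1, 2, 4} decide whether block 2 or 3 can; if neither, block 4
   can. *)
have [t2|t2] := ltnP d2 (p1 * p2 + p2); last have [t3|t3] := ltnP d3 (p1 * p3 + p3);
  last have [t4|t4] := ltnP d4 (p1 * p4 + p4);
  last have [t34|t34] := leqP (p3 * p4 + p1 * p3 + p3 + p1 * p4 + p4) (d3 + d4);
  last have [t24|t24] := leqP (p2 * p4 + p1 * p2 + p2 + p1 * p4 + p4) (d2 + d4);
  [constructor 1|constructor 2|constructor 3|constructor 1|constructor 2|constructor 3];
  rewrite /accepts1;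
  (have [p1E|p1E] : p1 = 1 \/ p1 = 2 by lia);
  subst p1; do 6?[apply/andP; split]; lia.
Qed.

(* With d_1 = p_1, one element goes to block 2 and the next p_1 to block 1. *)
Lemma skip12 p1 p2 p3 p4 d2 d3 d4 :
  (forall e2 e3 e4, admissible 0 p2 p3 p4 0 e2 e3 e4 ->
     realizable 0 p2 p3 p4 0 e2 e3 e4) ->
  admissible p1 p2.+1 p3 p4 p1 d2 d3 d4 -> accepts1 p1 p3 p4 p1 d3 d4 ->
  realizable p1 p2.+1 p3 p4 p1 d2 d3 d4.
Proof.
move=> rest adm acc; apply/realizable_swap12/realizable_top1; try by case/and5P: acc.
have := admissible_top1 (admissible_swap12 adm) acc; rewrite subnn.
by move/admissible_swap12 => adm'; apply/realizable_swap12/drain1.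
Qed.

(** Block 1 takes the largest element while d_1 < p_1, which leaves d_1 unchanged. A nonempty block
    reaches d_1 = p_1 only at size 1, where one element is skipped. *)
Lemma finish1_three p1 p2 p3 d1 d2 d3 :
  d1 <= 1 -> d1 <= p1 -> 1 < p2 -> 1 < p3 ->
  admissible p1 p2 p3 0 d1 d2 d3 0 -> realizable p1 p2 p3 0 d1 d2 d3 0.
Proof.
move=> d1_le1 + p2_gt1 p3_gt1.
have rest q2 q3 e2 e3 e4 :
    admissible 0 q2 q3 0 0 e2 e3 e4 -> realizable 0 q2 q3 0 0 e2 e3 e4.
  move=> adm; have e4E : e4 = 0 by move: adm; rewrite /admissible; lia.
  rewrite e4E in adm *; apply/realizable_swap13/realizable_two.
  exact: admissible_swap13.
elim: p1 d2 d3 => [|p1 IHp1] d2 d3; first by rewrite leqn0 => /eqP->; exact: rest.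
rewrite leq_eqVlt => /orP[/eqP d1E|lt1] adm; last first.
  apply: top1_step (adm) (tight1_accepts1 adm lt1) => q1 q2 q3 q4 e1 e2 e3 e4.
  by move=> -> -> -> -> -> _ _; rewrite leqn0 => /eqP->; exact: IHp1.
have {IHp1} p1E : p1 = 0 by lia.
subst p1 d1; have [acc|acc] := skip1_three p2_gt1 p3_gt1 adm.
  case: p2 p2_gt1 adm {acc}(acc) => // p2 _ adm acc.
  by apply: skip12 => // *; exact: rest.
apply: realizable_swap23; case: p3 p3_gt1 adm => // p3 _ adm.
apply: skip12; first by move=> *; exact: rest.
- by move: adm; rewrite /admissible; lia.
- by move: acc; rewrite /accepts1; lia.
Qed.

(** * Induction on the number of elements *)

Lemma loose_step1 p1 p2 p3 p4 d1 d2 d3 d4 :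
  (forall e1 e2 e3 e4,
     admissible p1 p2 p3 p4 e1 e2 e3 e4 -> realizable p1 p2 p3 p4 e1 e2 e3 e4) ->
  0 < p1 ->
  admissible p1.+1 p2 p3 p4 d1 d2 d3 d4 ->
  loose p1.+1 p2 p3 p4 d1 d2 d3 d4 ->
  loose p1.+1 p2 p3 p4
    (p1.+1 * (p2 + p3 + p4) - d1) (p2 * (p1.+1 + p3 + p4) - d2)
    (p3 * (p1.+1 + p2 + p4) - d3) (p4 * (p1.+1 + p2 + p3) - d4) ->
  realizable p1.+1 p2 p3 p4 d1 d2 d3 d4.
Proof.
move=> IH p1_gt0 adm lo lo'.
have step e1 e2 e3 e4 : admissible p1.+1 p2 p3 p4 e1 e2 e3 e4 ->
    accepts1 p2 p3 p4 e2 e3 e4 -> realizable p1.+1 p2 p3 p4 e1 e2 e3 e4.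
  by apply: top1_step => *; subst; exact: IH.
have [|acc|acc] := loose_accepts1 _ adm lo lo' => //; first exact: step.
by apply: realizable_flip (adm) _; apply: step acc; exact: admissible_flip.
Qed.

(* [C] is the class of size vectors under consideration, and [l] the size below
   which blocks are not decreased one element at a time. *)
Lemma descent (l : nat) (C : nat -> nat -> nat -> nat -> Prop) :
  1 < l ->
  (forall p1 p2 p3 p4, C p1 p2 p3 p4 ->
     [/\ C p2 p1 p3 p4, C p3 p2 p1 p4 & C p4 p2 p3 p1]) ->
  (forall p1 p2 p3 p4, l <= p1 -> C p1.+1 p2 p3 p4 -> C p1 p2 p3 p4) ->
  (forall p1 p2 p3 p4 d1 d2 d3 d4, C p1 p2 p3 p4 -> p1 <= l -> d1 < p1 ->
     admissible p1 p2 p3 p4 d1 d2 d3 d4 ->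
     realizable p1 p2 p3 p4 d1 d2 d3 d4) ->
  (forall p1 p2 p3 p4 d1 d2 d3 d4, C p1 p2 p3 p4 ->
     [&& p1 <= l, p2 <= l, p3 <= l & p4 <= l] ->
     admissible p1 p2 p3 p4 d1 d2 d3 d4 ->
     realizable p1 p2 p3 p4 d1 d2 d3 d4) ->
  forall p1 p2 p3 p4 d1 d2 d3 d4, C p1 p2 p3 p4 ->
    admissible p1 p2 p3 p4 d1 d2 d3 d4 -> realizable p1 p2 p3 p4 d1 d2 d3 d4.
Proof.
move=> l_gt1 C_swap C_pred1 finish1 all_small p1 p2 p3 p4 d1 d2 d3 d4.
have [n] := ubnP (p1 + p2 + p3 + p4).
elim: n => // n IHn in p1 p2 p3 p4 d1 d2 d3 d4 *.
have tight1 q1 q2 q3 q4 e1 e2 e3 e4 : q1 + q2 + q3 + q4 < n.+1 ->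
    C q1 q2 q3 q4 -> e1 < q1 -> admissible q1 q2 q3 q4 e1 e2 e3 e4 ->
    realizable q1 q2 q3 q4 e1 e2 e3 e4.
  move=> lt_n Cq lt1 adm; have [q1_le|q1_gt] := leqP q1 l; first exact: finish1.
  case: q1 => // q1 in lt_n Cq lt1 adm q1_gt *.
  by apply: top1_step (adm) (tight1_accepts1 adm lt1) => *; subst; apply: IHn => //;
    exact: C_pred1 Cq.
have tight q1 q2 q3 q4 e1 e2 e3 e4 : q1 + q2 + q3 + q4 < n.+1 ->
    C q1 q2 q3 q4 -> ~~ loose q1 q2 q3 q4 e1 e2 e3 e4 ->
    admissible q1 q2 q3 q4 e1 e2 e3 e4 -> realizable q1 q2 q3 q4 e1 e2 e3 e4.
  move=> lt_n Cq + adm; rewrite /loose !negb_and -!ltnNge => /or4P[] lt_i.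
  - exact: tight1.
  - apply/realizable_swap12/tight1 => //; first by lia.
      by case/C_swap: Cq.
    exact: admissible_swap12.
  - apply/realizable_swap13/tight1 => //; first by lia.
      by case/C_swap: Cq.
    exact: admissible_swap13.
  - apply/realizable_swap14/tight1 => //; first by lia.
      by case/C_swap: Cq.
    exact: admissible_swap14.
have big1 q1 q2 q3 q4 e1 e2 e3 e4 : q1 + q2 + q3 + q4 < n.+1 ->
    C q1 q2 q3 q4 -> l < q1 -> admissible q1 q2 q3 q4 e1 e2 e3 e4 ->
    realizable q1 q2 q3 q4 e1 e2 e3 e4.
  case: q1 => // q1 lt_n Cq q1_gt adm.
  have [lo|] := boolP (loose q1.+1 q2 q3 q4 e1 e2 e3 e4);
    last by move=> nlo; exact: tight nlo adm.
  have [lo'|nlo'] := boolP (loose q1.+1 q2 q3 q4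
    (q1.+1 * (q2 + q3 + q4) - e1) (q2 * (q1.+1 + q3 + q4) - e2)
    (q3 * (q1.+1 + q2 + q4) - e3) (q4 * (q1.+1 + q2 + q3) - e4)).
    apply: loose_step1 (adm) lo lo'; last by lia.
    by move=> *; apply: IHn => //; exact: C_pred1 Cq.
  (* The reflected vector is not loose, so the reflected problem is solved instead. *)
  by apply: realizable_flip (adm) _; apply: tight nlo' _ => //; exact: admissible_flip.
move=> le_n Cp adm.
have [gt1|le1] := ltnP l p1; first exact: big1.
have [gt2|le2] := ltnP l p2.
  apply/realizable_swap12/big1 => //; first by lia.
    by case/C_swap: Cp.
  exact: admissible_swap12.
have [gt3|le3] := ltnP l p3.
  apply/realizable_swap13/big1 => //; first by lia.
    by case/C_swap: Cp.
  exact: admissible_swap13.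
have [gt4|le4] := ltnP l p4.
  apply/realizable_swap14/big1 => //; first by lia.
    by case/C_swap: Cp.
  exact: admissible_swap14.
by apply: all_small => //; apply/and4P.
Qed.

(** * Three blocks *)

(** The empty block may be any of the four, since [descent] asks for a class closed under swaps. *)
Definition three_sizes (p1 p2 p3 p4 : nat) : Prop :=
  (p1 = 0 /\ 1 < p2 /\ 1 < p3 /\ 1 < p4) \/
  (p2 = 0 /\ 1 < p1 /\ 1 < p3 /\ 1 < p4) \/
  (p3 = 0 /\ 1 < p1 /\ 1 < p2 /\ 1 < p4) \/
  (p4 = 0 /\ 1 < p1 /\ 1 < p2 /\ 1 < p3).

Definition search_all222 : bool :=
  all (fun d1 => all (fun d2 =>
    let d3 := 12 - (d1 + d2) in
    if admissible 2 2 2 0 d1 d2 d3 0 then search 6 2 2 2 0 d1 d2 d3 0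
    else true) (iota 0 13)) (iota 0 13).

Lemma search_all222_holds : search_all222.
Proof. by vm_compute. Qed.

Lemma realizable222 d1 d2 d3 :
  admissible 2 2 2 0 d1 d2 d3 0 -> realizable 2 2 2 0 d1 d2 d3 0.
Proof.
move=> adm.
have [d1_lt d2_lt d3E] : [/\ d1 < 13, d2 < 13 & d3 = 12 - (d1 + d2)].
  by move: adm; rewrite /admissible; split; lia.
have d1_in : d1 \in iota 0 13 by rewrite mem_iota.
have d2_in : d2 \in iota 0 13 by rewrite mem_iota.
have /allP/(_ d1 d1_in)/allP/(_ d2 d2_in) := search_all222_holds.
by cbv zeta; rewrite -d3E adm => found; exact: searchP found.
Qed.

Lemma realizable_three p1 p2 p3 p4 d1 d2 d3 d4 :
  three_sizes p1 p2 p3 p4 -> admissible p1 p2 p3 p4 d1 d2 d3 d4 ->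
  realizable p1 p2 p3 p4 d1 d2 d3 d4.
Proof.
move: p1 p2 p3 p4 d1 d2 d3 d4; apply: (@descent 2) => //.
- by move=> p1 p2 p3 p4; rewrite /three_sizes => sizes; split; lia.
- by move=> p1 p2 p3 p4; rewrite /three_sizes; lia.
- move=> p1 p2 p3 p4 d1 d2 d3 d4 sizes p1_le2 lt1.
  have last0 q2 q3 q4 e2 e3 e4 : q4 = 0 -> 1 < q2 -> 1 < q3 ->
      admissible p1 q2 q3 q4 d1 e2 e3 e4 -> realizable p1 q2 q3 q4 d1 e2 e3 e4.
    move=> -> q2_gt1 q3_gt1 adm.
    have e4E : e4 = 0 by move: adm; rewrite /admissible; lia.
    by subst e4; apply: finish1_three adm => //; lia.
  move=> adm; case: sizes => [[p1E _]|[[p2E sizes]|[[p3E sizes]|[p4E sizes]]]].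
  + by rewrite p1E in lt1.
  + apply/realizable_swap34/realizable_swap23/realizable_swap34/last0; try lia.
    by move: adm; rewrite /admissible; lia.
  + by apply/realizable_swap34/last0; try lia; move: adm; rewrite /admissible; lia.
  + by apply: last0; lia.
move=> p1 p2 p3 p4 d1 d2 d3 d4 sizes /and4P[le1 le2 le3 le4].
have last0 e1 e2 e3 e4 :
    admissible 2 2 2 0 e1 e2 e3 e4 -> realizable 2 2 2 0 e1 e2 e3 e4.
  move=> adm; have e4E : e4 = 0 by move: adm; rewrite /admissible; lia.
  by subst e4; exact: realizable222.
case: sizes => [[p1E sizes]|[[p2E sizes]|[[p3E sizes]|[p4E sizes]]]] adm.
- have [p2E p3E p4E] : [/\ p2 = 2, p3 = 2 & p4 = 2] by split; lia.
  by subst; apply/realizable_swap14/last0/admissible_swap14.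
- have [p1E p3E p4E] : [/\ p1 = 2, p3 = 2 & p4 = 2] by split; lia.
  subst; apply/realizable_swap34/realizable_swap23/realizable_swap34/last0.
  by move: adm; rewrite /admissible; lia.
- have [p1E p2E p4E] : [/\ p1 = 2, p2 = 2 & p4 = 2] by split; lia.
  by subst; apply/realizable_swap34/last0; move: adm; rewrite /admissible; lia.
- have [p1E p2E p3E] : [/\ p1 = 2, p2 = 2 & p3 = 2] by split; lia.
  by subst; exact: last0.
Qed.

(** * Four blocks *)

(** At most one element goes elsewhere before block 1 is full, so the other sizes stay above 1, as
    [realizable_three] requires. *)
Lemma finish1_four p1 p2 p3 p4 d1 d2 d3 d4 :
  d1 <= 2 -> d1 <= p1 -> 2 < p2 -> 2 < p3 -> 2 < p4 ->
  admissible p1 p2 p3 p4 d1 d2 d3 d4 -> realizable p1 p2 p3 p4 d1 d2 d3 d4.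
Proof.
move=> d1_le2 + p2_gt2 p3_gt2 p4_gt2.
have rest q2 q3 q4 e2 e3 e4 : 1 < q2 -> 1 < q3 -> 1 < q4 ->
    admissible 0 q2 q3 q4 0 e2 e3 e4 -> realizable 0 q2 q3 q4 0 e2 e3 e4.
  by move=> *; apply: realizable_three => //; left.
elim: p1 d2 d3 d4 => [|p1 IHp1] d2 d3 d4.
  by rewrite leqn0 => /eqP->; apply: rest; exact: ltnW.
rewrite leq_eqVlt => /orP[/eqP d1E|lt1] adm; last first.
  by apply: top1_step (adm) (tight1_accepts1 adm lt1) => *; subst; exact: IHp1.
have p1_int : 0 < p1.+1 <= 2 by lia.
subst d1; have {IHp1} [acc|acc|acc] := skip1_four p1_int p2_gt2 p3_gt2 p4_gt2 adm.
- case: p2 p2_gt2 adm => // p2 p2_gt1 adm.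
  by apply: skip12 => // *; apply: rest => //; exact: ltnW.
- apply: realizable_swap23; case: p3 p3_gt2 adm => // p3 p3_gt1 adm.
  apply: skip12; first by move=> *; apply: rest => //; exact: ltnW.
  + by move: adm; rewrite /admissible; lia.
  + by move: acc; rewrite /accepts1; lia.
- apply/realizable_swap23/realizable_swap34/realizable_swap23.
  case: p4 p4_gt2 adm => // p4 p4_gt1 adm.
  apply: skip12; first by move=> *; apply: rest => //; exact: ltnW.
  + by move: adm; rewrite /admissible; lia.
  + by move: acc; rewrite /accepts1; lia.
Qed.

Lemma realizable_four p1 p2 p3 p4 d1 d2 d3 d4 :
  2 < p1 -> 2 < p2 -> 2 < p3 -> 2 < p4 ->
  admissible p1 p2 p3 p4 d1 d2 d3 d4 -> realizable p1 p2 p3 p4 d1 d2 d3 d4.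
Proof.
move=> p1_gt2 p2_gt2 p3_gt2 p4_gt2.
apply: (@descent 3 (fun p1 p2 p3 p4 => [&& 2 < p1, 2 < p2, 2 < p3 & 2 < p4]));
  last by apply/and4P.
- by [].
- by move=> q1 q2 q3 q4 sizes; split; lia.
- by move=> q1 q2 q3 q4; lia.
- move=> q1 q2 q3 q4 e1 e2 e3 e4 /and4P[_ q2_gt2 q3_gt2 q4_gt2] q1_le3 lt1.
  by apply: finish1_four => //; lia.
move=> q1 q2 q3 q4 e1 e2 e3 e4 sizes le3.
have [-> -> -> ->] : [/\ q1 = 3, q2 = 3, q3 = 3 & q4 = 3] by split; lia.
exact: realizable3333.
Qed.

(** * Sums of the largest elements *)

Definition top_sum (n m : nat) : nat := \sum_(1 <= i < m.+1) (n - i + 1).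

Lemma top_sum_closed n m : m <= n -> 2 * top_sum n m + m ^ 2 = m * (2 * n).+1.
Proof.
elim: m => [|m IHm] le_mn; first by rewrite /top_sum big_geq.
by have := IHm (ltnW le_mn); rewrite /top_sum [in X in _ -> X]big_nat_recr //=; lia.
Qed.

Lemma leq_top_sum n m m' : m <= m' -> top_sum n m <= top_sum n m'.
Proof.
move=> le_mm'.
by rewrite /top_sum [leqRHS](big_cat_nat _ (n := m.+1)) //= leq_addr.
Qed.

Lemma sum_leq_top_sum n (X : {set 'I_n.+1}) :
  \sum_(a in X) (a : nat) <= top_sum n #|X|.
Proof.
move mE: #|X| => m; elim: m X mE => [|m IHm] X XE.
  by rewrite (cards0_eq XE) big_set0.
have [x0 x0X] : exists x, x \in X by apply/set0Pn; rewrite -card_gt0 XE.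
have [a aX a_min] := arg_minnP (fun a : 'I_n.+1 => a : nat) x0X.
have {}aX : a \in X := aX.
(* The m + 1 elements of [X] lie between [a] and n, so the minimum is at most the last summand of
   [top_sum n m.+1]. *)
have le_a : a + m <= n.
  have : X \subset [set b : 'I_n.+1 | a <= b].
    by apply/subsetP => b bX; rewrite inE a_min.
  move/subset_leq_card; rewrite XE -sum1_card.
  have -> : \sum_(b in [set b : 'I_n.+1 | a <= b]) 1 = n.+1 - a.
    rewrite (eq_bigl (fun b : 'I_n.+1 => a <= b)); last by move=> b; rewrite inE.
    rewrite -(big_mkord (fun b => a <= b) (fun=> 1)).
    rewrite (big_cat_nat _ (n := a)) //=; last exact: ltnW.
    rewrite big1_seq ?add0n; last first.
      by move=> b /andP[]; rewrite mem_index_iota; lia.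
    rewrite big_nat_cond (eq_bigl (fun b => a <= b < n.+1)); last by move=> b; lia.
    by rewrite -big_nat sum_nat_const_nat muln1.
  by have := ltn_ord a; lia.
rewrite (big_setD1 a) //= /top_sum big_nat_recr //= addnC leq_add //.
  by apply: IHm; move: XE; rewrite (cardsD1 a) aX => -[].
by lia.
Qed.

Lemma sum_ord4 (F : 'I_4 -> nat) :
  \sum_(i < 4) F i = F (inord 0) + F (inord 1) + F (inord 2) + F (inord 3).
Proof.
rewrite !big_ord_recl big_ord0 addn0 !addnA.
by do 3?[congr (_ + _)]; congr (F _); apply/val_inj; rewrite /= inordK.
Qed.

Lemma magic_sum4 n : 4 %| 'C(n.+1, 2) -> 8 * magic_sum n 4 = n * n.+1.
Proof.
move=> /divnK s_int; have := mul_bin_diag n.+1 1.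
by rewrite bin1 /= /magic_sum; lia.
Qed.

(** * From words to partitions, and necessity *)

(** Positive sizes make the blocks nonempty, which gives injectivity as well as a genuine
    partition. *)
Lemma partition_of_word n (w : seq 'I_4) (p : 'I_4 -> nat) (s : nat) :
  size w = n -> (forall c, 0 < p c) -> (forall c, count_mem c w = p c) ->
  (forall c, word_sum ord0 id c w = s) ->
  exists A : 'I_4 -> {set 'I_n.+1},
    [/\ labeled_partition A (interval1 n), forall i : 'I_4, #|A i| = p i &
        forall i : 'I_4, \sum_(a in A i) (a : nat) = s].
Proof.
move=> size_w p_gt0 count_w sum_w.
pose A (c : 'I_4) := [set a : 'I_n.+1 | (0 < a) && (nth ord0 w (n - a) == c)].
have sumA F c : \sum_(a in A c) F (a : nat) = word_sum ord0 F c w.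
  by rewrite /word_sum size_w; apply: eq_bigl => a; rewrite inE.
have cardA c : #|A c| = p c by rewrite -sum1_card (sumA (fun=> 1)) word_sum1.
exists A; split=> [|//|c]; last by rewrite (sumA id).
have disjA c c' a : a \in A c -> a \in A c' -> c = c'.
  by rewrite !inE => /andP[_ /eqP<-] /andP[_ /eqP<-].
have A_neq0 c : A c != set0 by rewrite -card_gt0 cardA.
split.
  move=> c c' eqA; have /set0Pn[a aA] := A_neq0 c.
  by apply: (disjA _ _ a) => //; rewrite -eqA.
apply/and3P; split.
- apply/eqP/setP => a; apply/bigcupP/idP => [[_ /imsetP[c _ ->]]|].
    by rewrite !inE => /andP[].
  rewrite inE => a_gt0; exists (A (nth ord0 w (n - a))); first exact: imset_f.
  by rewrite inE a_gt0 eqxx.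
- apply/trivIsetP => _ _ /imsetP[c _ ->] /imsetP[c' _ ->] neqA.
  rewrite -setI_eq0; apply: contraNT neqA => /set0Pn[a /setIP[aA aA']].
  by rewrite (disjA _ _ _ aA aA').
- by apply/imsetP => -[c _ /eqP]; rewrite eq_sym (negPf (A_neq0 c)).
Qed.

Lemma labeled_partition_sum k (T : finType) (A : 'I_k -> {set T}) D (j : nat)
    (F : T -> nat) :
  labeled_partition A D ->
  \sum_(a in \bigcup_(i < k | i < j) A i) F a
  = \sum_(i < k | i < j) \sum_(a in A i) F a.
Proof.
move=> [A_inj /and3P[_ /trivIsetP trivA _]].
rewrite [in RHS]big_mkcond (big_mkcond (fun i : 'I_k => i < j)) /=.
rewrite partition_disjoint_bigcup => [|i i' neq_i].
  by apply: eq_bigr => i _; case: ifP => // _; rewrite big_set0.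
have dis : [disjoint A i & A i'].
  by apply: trivA; rewrite ?imset_f // (inj_eq A_inj).
by case: ifP; case: ifP => // *; rewrite -setI_eq0 ?setI0 ?set0I.
Qed.

Lemma partial_sum4 (p : 'I_4 -> nat) :
  [/\ partial_sum p 1 = p (inord 0),
      partial_sum p 2 = p (inord 0) + p (inord 1) &
      partial_sum p 3 = p (inord 0) + p (inord 1) + p (inord 2)].
Proof.
by split; rewrite /partial_sum big_mkcond sum_ord4 /= !inordK //= !addn0.
Qed.

Lemma necessity n (p : 'I_4 -> nat) (s : nat) (A : 'I_4 -> {set 'I_n.+1}) j :
  labeled_partition A (interval1 n) -> (forall i, #|A i| = p i) ->
  (forall i, \sum_(a in A i) (a : nat) = s) -> 1 <= j <= 4 ->
  j * s <= top_sum n (partial_sum p j).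
Proof.
move=> partA cardA sumA j_int.
have sumU := labeled_partition_sum j _ partA.
have -> : partial_sum p j = #|\bigcup_(i < 4 | i < j) A i|.
  rewrite -sum1_card sumU; apply: eq_bigr => i _.
  by rewrite sum1_card cardA.
apply: leq_trans (sum_leq_top_sum _).
rewrite sumU (eq_bigr (fun=> s)) // big_mkcond sum_ord4 /= !inordK //.
by case: j j_int {sumU} => [|[|[|[|[|j]]]]] //= _; lia.
Qed.

(** * Sufficiency for equal sums *)

(** The case n = 8: here s = 9 and each d_i is 8 + 7 - 9 = 6. *)
Lemma search2222 : search 8 2 2 2 2 6 6 6 6.
Proof. by vm_compute. Qed.

Lemma sufficiency n (p : 'I_4 -> nat) (s : nat) :
  4 < n -> 8 * s = n * n.+1 -> 1 < p ord0 ->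
  (forall i j : 'I_4, i <= j -> p i <= p j) -> \sum_(i < 4) p i = n ->
  (forall j, 1 <= j <= 4 -> j * s <= top_sum n (partial_sum p j)) ->
  exists A : 'I_4 -> {set 'I_n.+1},
    [/\ labeled_partition A (interval1 n), forall i : 'I_4, #|A i| = p i &
        forall i : 'I_4, \sum_(a in A i) (a : nat) = s].
Proof.
move=> n_gt4 sE p0_gt1 p_mono p_sum h.
have [P1 P2 P3] := partial_sum4 p.
have := h 1 isT; have := h 2 isT; have := h 3 isT.
rewrite {}P1 {}P2 {}P3 {h}.
have q01 : p (inord 0) <= p (inord 1) by apply: p_mono; rewrite !inordK.
have q12 : p (inord 1) <= p (inord 2) by apply: p_mono; rewrite !inordK.
have q23 : p (inord 2) <= p (inord 3) by apply: p_mono; rewrite !inordK.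
have pE c : p c = nth 0 [:: p (inord 0); p (inord 1); p (inord 2); p (inord 3)] c.
  by ord4 c; congr (p _); apply/val_inj; rewrite /= inordK.
have q0_gt1 : 1 < p (inord 0) by move: p0_gt1; rewrite pE.
move: p_sum; rewrite sum_ord4.
move: (p (inord 0)) (p (inord 1)) (p (inord 2)) (p (inord 3)) q01 q12 q23 q0_gt1 pE.
move=> p1 p2 p3 p4 q12 q23 q34 p1_gt1 pE p_sum h3 h2 h1.
(* By monotonicity of [top_sum], the condition for P_k extends to the total size of any k blocks. *)
have bound k m m' : k * s <= top_sum n m -> m <= m' -> m' <= n ->
    2 * (k * s) + m' ^ 2 <= m' * (2 * n).+1.
  move=> le_ks le_mm' le_m'n; rewrite -(top_sum_closed le_m'n) leq_add2r leq_mul2l /=.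
  exact: leq_trans le_ks (leq_top_sum _ le_mm').
have slackE q : p1 <= q -> q <= n ->
    2 * (top_sum n q - s) + 2 * s + q ^ 2 = q * (2 * n).+1.
  move=> le_pq le_qn; rewrite -(top_sum_closed le_qn) -mulnDr subnK //.
  by rewrite -[s]mul1n; apply: leq_trans h1 (leq_top_sum _ le_pq).
have real : realizable p1 p2 p3 p4 (top_sum n p1 - s) (top_sum n p2 - s)
    (top_sum n p3 - s) (top_sum n p4 - s).
  have [n8|n_neq8] := eqVneq n 8.
    have sE9 : s = 9 by move: sE; rewrite n8; lia.
    have [-> -> -> ->] : [/\ p1 = 2, p2 = 2, p3 = 2 & p4 = 2] by split; lia.
    have -> : top_sum n 2 - s = 6 by rewrite n8 sE9 /top_sum unlock.
    exact: searchP search2222.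
  (* If p_1 = 2, then s <= 2n - 1, so n <= 14; but 8 divides n(n + 1) for no n from 9 to 14. *)
  have p1_gt2 : 2 < p1.
    rewrite ltn_neqAle p1_gt1 andbT; apply/eqP => p1E.
    have n_ge8 : 8 < n by lia.
    have := bound 1 _ _ h1 (leqnn _); rewrite -p1E => /(_ (ltnW (ltnW (ltnW n_gt4)))) b1.
    have n_le14 : n < 15 by clear - sE b1; nia.
    have : n \in iota 9 6 by rewrite mem_iota n_ge8.
    by rewrite !inE; do 5?[case/orP]; move=> /eqP nE; move: sE; rewrite nE; clear; lia.
  have E1 := slackE p1 (leqnn _) ltac:(lia); have E2 := slackE p2 q12 ltac:(lia).
  have E3 := slackE p3 (leq_trans q12 q23) ltac:(lia).
  have E4 := slackE p4 (leq_trans q12 (leq_trans q23 q34)) ltac:(lia).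
  move: E1 E2 E3 E4; move: (top_sum n p1 - s) (top_sum n p2 - s).
  move: (top_sum n p3 - s) (top_sum n p4 - s) => d3 d4 d1 d2 E1 E2 E3 E4.
  apply: realizable_four; try by clear - p1_gt2 q12 q23 q34; lia.
  have dE : d1 + d2 + d3 + d4
      = p1 * p2 + p1 * p3 + p1 * p4 + p2 * p3 + p2 * p4 + p3 * p4.
    by clear - E1 E2 E3 E4 sE p_sum; subst n; lia.
  (* Adding the two equations and comparing with the bound at size q + r, the cross term of (q +
     r)^2 yields q r. *)
  have pair q r e f : 2 * e + 2 * s + q ^ 2 = q * (2 * n).+1 ->
      2 * f + 2 * s + r ^ 2 = r * (2 * n).+1 -> p1 + p2 <= q + r <= n ->
      q * r <= e + f.
    move=> Eq Er /andP[le_qr qr_le].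
    by have := bound 2 _ _ h2 le_qr qr_le; clear - Eq Er; lia.
  have triple q r t e f g : 2 * e + 2 * s + q ^ 2 = q * (2 * n).+1 ->
      2 * f + 2 * s + r ^ 2 = r * (2 * n).+1 ->
      2 * g + 2 * s + t ^ 2 = t * (2 * n).+1 -> p1 + p2 + p3 <= q + r + t <= n ->
      q * r + q * t + r * t <= e + f + g.
    move=> Eq Er Et /andP[le_qrt qrt_le].
    by have := bound 3 _ _ h3 le_qrt qrt_le; clear - Eq Er Et; lia.
  have d12 : p1 * p2 <= d1 + d2.
    by apply: pair E1 E2 _; clear - q12 q23 q34 p_sum; lia.
  have d13 : p1 * p3 <= d1 + d3.
    by apply: pair E1 E3 _; clear - q12 q23 q34 p_sum; lia.
  have d14 : p1 * p4 <= d1 + d4.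
    by apply: pair E1 E4 _; clear - q12 q23 q34 p_sum; lia.
  have d23 : p2 * p3 <= d2 + d3.
    by apply: pair E2 E3 _; clear - q12 q23 q34 p_sum; lia.
  have d24 : p2 * p4 <= d2 + d4.
    by apply: pair E2 E4 _; clear - q12 q23 q34 p_sum; lia.
  have d34 : p3 * p4 <= d3 + d4.
    by apply: pair E3 E4 _; clear - q12 q23 q34 p_sum; lia.
  have d123 : p1 * p2 + p1 * p3 + p2 * p3 <= d1 + d2 + d3.
    by apply: triple E1 E2 E3 _; clear - q12 q23 q34 p_sum; lia.
  have d124 : p1 * p2 + p1 * p4 + p2 * p4 <= d1 + d2 + d4.
    by apply: triple E1 E2 E4 _; clear - q12 q23 q34 p_sum; lia.
  have d134 : p1 * p3 + p1 * p4 + p3 * p4 <= d1 + d3 + d4.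
    by apply: triple E1 E3 E4 _; clear - q12 q23 q34 p_sum; lia.
  have d234 : p2 * p3 + p2 * p4 + p3 * p4 <= d2 + d3 + d4.
    by apply: triple E2 E3 E4 _; clear - q12 q23 q34 p_sum; lia.
  rewrite /admissible dE eqxx d12 d13 d14 d23 d24 d34 /=.
  by clear - dE d123 d124 d134 d234; do 3?[apply/andP; split]; lia.
have [w wE] := real.
have size_w : size w = n.
  rewrite -sum1_size (partition_big id xpredT) //= sum_ord4 !sum1_count.
  by rewrite !(proj1 (wE _)) !inordK.
apply: (partition_of_word size_w) => c.
- by rewrite pE; ord4 c; lia.
- by rewrite (proj1 (wE c)) pE.
(* Block sum plus slack is the sum of the largest elements, so the prescribed slack forces the block
   sum s. *)
have := word_sum_slack ord0 c w; rewrite size_w; have [-> ->] := wE c.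
have := slackE (p c).
rewrite pE; ord4 c; move: (word_sum _ _ _ _) => W; lia.
Qed.

Theorem theorem1 (n : nat) (p : 'I_4 -> nat)
    (n_gt4 : 4 < n)
    (s_int : 4 %| 'C(n.+1, 2))
    (p_gt1 : 1 < p ord0)
    (p_mono : forall i j : 'I_4, i <= j -> p i <= p j)
    (p_sum : \sum_(i < 4) p i = n) :
  (exists A : 'I_4 -> {set 'I_n.+1},
    [/\ labeled_partition A (interval1 n),
        forall i : 'I_4, #|A i| = p i &
        forall i : 'I_4, \sum_(a in A i) (a : nat) = magic_sum n 4])
  <->
  (forall j : nat, 1 <= j <= 4 ->
    j * magic_sum n 4 <= \sum_(1 <= i < (partial_sum p j).+1) (n - i + 1)).
Proof.
split=> [[A [partA cardA sumA]] j|]; first exact: necessity partA cardA sumA.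
by apply: sufficiency => //; exact: magic_sum4.
Qed.
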